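(* Let $x,y$ be independent variables. The Laurent polynomial ring $\mathbb{Z}[x,x^{-1},y,y^{-1}]$ is a free module over its subring $\mathbb{Z}[x+x^{-1},y+y^{-1}]$.
   Context: Under the isomorphism $\mathfrak{so}_4\cong\mathfrak{sl}_2\times\mathfrak{sl}_2$, the ring $\mathbb{Z}[x+x^{-1},y+y^{-1}]\cong\mathbb{Z}[x+x^{-1}]\otimes\mathbb{Z}[y+y^{-1}]$ is the representation ring of $\mathfrak{so}_4$, and $\mathbb{Z}[x,x^{-1},y,y^{-1}]\cong\mathbb{Z}[x,x^{-1}]\otimes\mathbb{Z}[y,y^{-1}]$ is the representation ring of its Cartan subalgebra. The module structure is the one given by the inclusion of rings. *)

(* Defs.v *)
From HB Require Import structures.
From mathcomp Require Import all_boot all_order all_algebra.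
From mathcomp Require Import boolp.
From mathcomp Require Import mpoly.

Set Implicit Arguments.
Unset Strict Implicit.
Unset Printing Implicit Defensive.

Import GRing.Theory.
Local Open Scope ring_scope.

(* Free modules, with no finiteness assumption on the index type. *)
Section Free.
Context (R : nzRingType) (M : lmodType R).

Definition lin_indep (I : eqType) (b : I -> M) : Prop :=
  forall (s : seq I) (c : I -> R), uniq s ->
    \sum_(i <- s) c i *: b i = 0 -> forall i, i \in s -> c i = 0.

Definition spanning (I : eqType) (b : I -> M) : Prop :=
  forall m : M, exists (s : seq I) (c : I -> R),
    m = \sum_(i <- s) c i *: b i.

Definition free_module : Prop :=
  exists (I : eqType) (b : I -> M), lin_indep b /\ spanning b.

End Free.

(* The ring A seen as an R-module along f : R -> A, i.e. r *: a = f r * a. *)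
Section RestrictScalars.
Context (R A : nzRingType).

Definition restr_scalars (f : {rmorphism R -> A}) : Type := A.

Context (f : {rmorphism R -> A}).

HB.instance Definition _ := GRing.Zmodule.on (restr_scalars f).

Let scale (r : R) (a : restr_scalars f) : restr_scalars f := f r * (a : A).

Fact restr_scalars_scaleA r s a : scale r (scale s a) = scale (r * s) a.
Proof. by rewrite /scale rmorphM mulrA. Qed.

Fact restr_scalars_scale1 : left_id 1 scale.
Proof. by move=> a; rewrite /scale rmorph1 mul1r. Qed.

Fact restr_scalars_scaleDr : right_distributive scale +%R.
Proof. by move=> r a b; rewrite /scale mulrDr. Qed.

Fact restr_scalars_scaleDl a : {morph scale^~ a : r s / r + s}.
Proof. by move=> r s; rewrite /scale rmorphD mulrDl. Qed.

HB.instance Definition _ := GRing.Zmodule_isLmodule.Build R (restr_scalars f)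
  restr_scalars_scaleA restr_scalars_scale1
  restr_scalars_scaleDr restr_scalars_scaleDl.

End RestrictScalars.

(* The subring Z[a_0, ..., a_(n-1)] of a commutative ring R: the values at a
   of the polynomials in n variables with integer coefficients. *)
Section Zadjoin.
Context (R : comNzRingType) (n : nat) (a : n.-tuple R).

Definition Zeval (P : {mpoly int[n]}) : R := mmap intr (tnth a) P.

Definition Zadjoin_pred : {pred R} :=
  fun z => `[< exists P : {mpoly int[n]}, z = Zeval P >].

Fact Zadjoin_subring_closed : subring_closed Zadjoin_pred.
Proof.
split=> [|u v|u v].
- by apply/asboolP; exists 1; rewrite /Zeval rmorph1.
- move=> /asboolP[P ->] /asboolP[Q ->]; apply/asboolP.
  by exists (P - Q); rewrite /Zeval rmorphB.
- move=> /asboolP[P ->] /asboolP[Q ->]; apply/asboolP.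
  by exists (P * Q); rewrite /Zeval rmorphM.
Qed.

HB.instance Definition _ :=
  GRing.isSubringClosed.Build R Zadjoin_pred Zadjoin_subring_closed.

Record Zadjoin : Type := MkZadjoin {
  Zadjoin_val :> R;
  Zadjoin_valP : Zadjoin_val \in Zadjoin_pred }.

HB.instance Definition _ := [isSub for Zadjoin_val].
HB.instance Definition _ := [Choice of Zadjoin by <:].
HB.instance Definition _ := [SubChoice_isSubComNzRing of Zadjoin by <:].

Fact Zgen_subproof (i : 'I_n) : tnth a i \in Zadjoin_pred.
Proof. by apply/asboolP; exists 'X_i; rewrite /Zeval mmapX mmap1U. Qed.

Definition Zgen (i : 'I_n) : Zadjoin := MkZadjoin (Zgen_subproof i).

(* R as a module over its subring Z[a_0, ..., a_(n-1)]. *)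
Definition Zadjoin_mod : lmodType Zadjoin :=
  restr_scalars (val : {rmorphism Zadjoin -> R}).

End Zadjoin.

(* Z[x, x^-1, y, y^-1] is taken inside the fraction field Q(x, y) of Z[x, y]. *)
Definition Qxy : fieldType := {fraction {mpoly int[2]}}.

Definition var_x : Qxy := tofrac 'X_(inord 0).
Definition var_y : Qxy := tofrac 'X_(inord 1).

Definition laurent : comNzRingType :=
  Zadjoin [tuple var_x; var_x^-1; var_y; var_y^-1].

Definition lx : laurent := Zgen _ (inord 0).
Definition lxV : laurent := Zgen _ (inord 1).
Definition ly : laurent := Zgen _ (inord 2).
Definition lyV : laurent := Zgen _ (inord 3).

Fact val_lx : val lx = var_x. Proof. by rewrite /= (tnth_nth 0) inordK. Qed.
Fact val_lxV : val lxV = var_x^-1. Proof. by rewrite /= (tnth_nth 0) inordK. Qed.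
Fact val_ly : val ly = var_y. Proof. by rewrite /= (tnth_nth 0) inordK. Qed.
Fact val_lyV : val lyV = var_y^-1. Proof. by rewrite /= (tnth_nth 0) inordK. Qed.

(* Main.v *)
Require Import Defs.
From mathcomp Require Import all_boot all_order all_algebra.
From mathcomp Require Import boolp mpoly ring.

Set Implicit Arguments.
Unset Strict Implicit.
Unset Printing Implicit Defensive.

Import GRing.Theory.
Local Open Scope ring_scope.

(* The monomials 1, x, y, xy form a basis. They span because their span is
   closed under multiplication, by x^2 = (x + x^-1) x - 1 and the same identity
   in y. They are independent because a linear relation with symmetric
   coefficients survives the substitutions x -> x^-1 and y -> y^-1: subtracting
   the relation obtained from the original one leaves multiples of x - x^-1
   and y - y^-1, which can be cancelled. *)

(** * Induction for integer polynomials and for the rings [Zadjoin] *)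

Lemma int_mpoly_ind n (K : {mpoly int[n]} -> Prop) :
  K 1 -> (forall p q, K p -> K q -> K (p - q)) ->
  (forall p q, K p -> K q -> K (p * q)) -> (forall i, K 'X_i) ->
  forall p, K p.
Proof.
move=> K1 KB KM KX.
(* Differences alone produce 0, then opposites and sums, hence all integer multiples; as the
   coefficients are integers, no closure under scalars has to be assumed. *)
have K0 : K 0 by rewrite -(subrr 1); apply: (KB).
have KD p q : K p -> K q -> K (p + q).
  by move=> Kp Kq; rewrite -[q]opprK -[- q]sub0r; apply/KB/KB.
have KMn p k : K p -> K (p *+ k).
  by move=> Kp; elim: k => [|k IHk]; rewrite ?mulr0n // mulrS; apply: (KD).
move=> p; rewrite [p]mpolyE; elim/big_rec: _ => // m q _ Kq; apply: (KD) => //.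
have Km : K 'X_[m].
  rewrite mpolyXE_id; elim/big_rec: _ => // i r _ Kr; apply: (KM) => //.
  by elim: (m i) => [|k IHk]; rewrite ?expr0 // exprS; apply: (KM).
rewrite -[p@_m]intz scaler_int; case: (p@_m) => k; first exact: (KMn).
by rewrite NegzE mulrNz -sub0r; apply/KB/KMn.
Qed.

Lemma rmorph_mmap_int n (R S : comNzRingType) (f : {rmorphism R -> S})
    (h : 'I_n -> R) (P : {mpoly int[n]}) :
  f (mmap intr h P) = mmap intr (f \o h) P.
Proof.
elim/int_mpoly_ind: P => [|p q IHp IHq|p q IHp IHq|i].
- by rewrite !rmorph1.
- by rewrite !rmorphB IHp IHq.
- by rewrite !rmorphM IHp IHq.
- by rewrite !mmapX !mmap1U.
Qed.

(** An element is a polynomial value at the generators in [R]; since [val] is an injective morphism,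
    the same polynomial evaluated inside [Zadjoin a] gives it back, and induction on polynomials
    applies. *)
Lemma Zadjoin_ind (R : comNzRingType) n (a : n.-tuple R)
    (K : Zadjoin a -> Prop) :
  K 1 -> (forall u v, K u -> K v -> K (u - v)) ->
  (forall u v, K u -> K v -> K (u * v)) -> (forall i, K (Zgen a i)) ->
  forall z, K z.
Proof.
move=> K1 KB KM KX z.
have /asboolP[P zP] := Zadjoin_valP z.
have -> : z = mmap intr (Zgen a) P.
  by apply: val_inj; rewrite rmorph_mmap_int.
elim/int_mpoly_ind: P {zP} => [|p q IHp IHq|p q IHp IHq|i].
- by rewrite rmorph1.
- by rewrite rmorphB; apply: (KB).
- by rewrite rmorphM; apply: (KM).
- by rewrite mmapX mmap1U.
Qed.

(** Laurent polynomials are encoded as functions so that other values can be substituted for the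
    variables. One exponent and one numerator must serve all nonzero points at once; nothing is
    required at zero, where the inverse is the default value 0. *)
Definition Laurent_fun (F : fieldType) (f : F -> F -> F) : Prop :=
  exists (N : nat) (Q : {mpoly int[2]}), forall a b, a != 0 -> b != 0 ->
    (a * b) ^+ N * f a b = mmap intr (tnth [tuple a; b]) Q.

(** * Closure properties of Laurent polynomial functions *)

Section LaurentFun.
Variable F : fieldType.
Implicit Types f g : F -> F -> F.

Lemma Laurent_fun1 : Laurent_fun (fun _ _ : F => 1).
Proof. by exists 0, 1 => a b _ _; rewrite rmorph1 mulr1. Qed.

Lemma Laurent_fun_fst : Laurent_fun (fun a _ : F => a).
Proof.
by exists 0, 'X_0 => a b _ _; rewrite mmapX mmap1U mul1r.
Qed.

Lemma Laurent_fun_snd : Laurent_fun (fun _ b : F => b).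
Proof.
by exists 0, 'X_1 => a b _ _; rewrite mmapX mmap1U mul1r.
Qed.

Lemma Laurent_fun_fstV : Laurent_fun (fun a _ : F => a^-1).
Proof.
(* Multiplying [a^-1] by [a * b] leaves the other variable as numerator. *)
exists 1, 'X_1 => a b a0 _.
by rewrite mmapX mmap1U expr1 mulrAC mulfV // mul1r.
Qed.

Lemma Laurent_fun_sndV : Laurent_fun (fun _ b : F => b^-1).
Proof.
exists 1, 'X_0 => a b _ b0.
by rewrite mmapX mmap1U expr1 mulfK.
Qed.

Lemma Laurent_funB f g : Laurent_fun f -> Laurent_fun g ->
  Laurent_fun (fun a b => f a b - g a b).
Proof.
move=> [N [P fP]] [M [Q gQ]].
exists (N + M)%N, (('X_0 * 'X_1) ^+ M * P - ('X_0 * 'X_1) ^+ N * Q).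
move=> a b a0 b0; rewrite rmorphB !rmorphM !rmorphXn !rmorphM /=.
rewrite !mmapX !mmap1U -fP // -gQ // !(tnth_nth 0) /= exprD.
by ring.
Qed.

Lemma Laurent_funM f g : Laurent_fun f -> Laurent_fun g ->
  Laurent_fun (fun a b => f a b * g a b).
Proof.
move=> [N [P fP]] [M [Q gQ]]; exists (N + M)%N, (P * Q) => a b a0 b0.
by rewrite rmorphM /= -fP // -gQ // exprD mulrACA.
Qed.

Lemma Laurent_funD f g : Laurent_fun f -> Laurent_fun g ->
  Laurent_fun (fun a b => f a b + g a b).
Proof.
move=> Lf Lg; have L1 := Laurent_fun1.
(* The sum is written as f - ((1 - 1) - g). *)
have := Laurent_funB Lf (Laurent_funB (Laurent_funB L1 L1) Lg).
by congr Laurent_fun; apply/funext => a; apply/funext => b; ring.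
Qed.

Lemma Laurent_fun_mmap n (h : F -> F -> 'I_n -> F) (P : {mpoly int[n]}) :
  (forall i, Laurent_fun (fun a b => h a b i)) ->
  Laurent_fun (fun a b => mmap intr (h a b) P).
Proof.
move=> Lh; elim/int_mpoly_ind: P => [|p q IHp IHq|p q IHp IHq|i].
- have := Laurent_fun1; congr Laurent_fun.
  by apply/funext => a; apply/funext => b; rewrite rmorph1.
- have := Laurent_funB IHp IHq; congr Laurent_fun.
  by apply/funext => a; apply/funext => b; rewrite rmorphB.
- have := Laurent_funM IHp IHq; congr Laurent_fun.
  by apply/funext => a; apply/funext => b; rewrite rmorphM.
- have := Lh i; congr Laurent_fun.
  by apply/funext => a; apply/funext => b; rewrite mmapX mmap1U.
Qed.

End LaurentFun.

(** * The indeterminates in the fraction field, and specialization *)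

Lemma mpolyX_neq0 n (i : 'I_n) : 'X_i != 0 :> {mpoly int[n]}.
Proof.
apply/eqP => /(congr1 (mcoeff U_(i)%MM))/eqP.
by rewrite mcoeffXU eqxx mcoeff0.
Qed.

(** Equality would make the square of the indeterminate equal to 1 already among polynomials, but
    their constant coefficients are 0 and 1. *)
Lemma tofracX_neqV n (i : 'I_n) :
  tofrac 'X_i != (tofrac 'X_i)^-1 :> {fraction {mpoly int[n]}}.
Proof.
have X0 : tofrac 'X_i != 0 :> {fraction {mpoly int[n]}}.
  by rewrite tofrac_eq0 mpolyX_neq0.
apply/eqP => XV.
have : tofrac ('X_i ^+ 2) = 1 :> {fraction {mpoly int[n]}}.
  by rewrite tofracXn expr2 [X in _ * X]XV mulfV.
move/eqP; rewrite -tofrac1 tofrac_eq => /eqP/(congr1 (mcoeff 0%MM))/eqP.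
by rewrite mcoeffXn mcoeff1 eqxx mulmS mnmD_eq0 mnm1_eq0.
Qed.

Lemma var_x_neq0 : var_x != 0.
Proof. by rewrite tofrac_eq0 mpolyX_neq0. Qed.

Lemma var_y_neq0 : var_y != 0.
Proof. by rewrite tofrac_eq0 mpolyX_neq0. Qed.

Lemma inord0_I2 : inord 0 = 0 :> 'I_2. Proof. exact/val_inj/inordK. Qed.
Lemma inord1_I2 : inord 1 = 1 :> 'I_2. Proof. exact/val_inj/inordK. Qed.

Lemma mmap_vars (Q : {mpoly int[2]}) :
  mmap intr (tnth [tuple var_x; var_y]) Q = tofrac Q :> Qxy.
Proof.
elim/int_mpoly_ind: Q => [|p q IHp IHq|p q IHp IHq|i].
- by rewrite !rmorph1.
- by rewrite !rmorphB /= IHp IHq.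
- by rewrite !rmorphM /= IHp IHq.
- rewrite mmapX mmap1U /var_x /var_y inord0_I2 inord1_I2.
  by case: i => [[|[|//]] lt_i]; rewrite (tnth_nth 0) /=; congr (tofrac 'X__);
    apply: val_inj.
Qed.

(* Clearing denominators turns a vanishing Laurent polynomial in the
   indeterminates into the zero polynomial, which vanishes everywhere. *)
Lemma Laurent_fun_specialize (f : Qxy -> Qxy -> Qxy) (a b : Qxy) :
  Laurent_fun f -> f var_x var_y = 0 -> a != 0 -> b != 0 -> f a b = 0.
Proof.
move=> [N [Q fQ]] f0 a0 b0.
have := fQ _ _ var_x_neq0 var_y_neq0.
rewrite f0 mulr0 mmap_vars => /esym/eqP; rewrite tofrac_eq0 => /eqP Q0.
have /eqP := fQ _ _ a0 b0.
rewrite Q0 rmorph0 mulf_eq0 expf_eq0 mulf_eq0 (negPf a0) (negPf b0) andbF /=.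
by move/eqP.
Qed.

(** The two equations form a linear system in p, q with determinant x^-1 - x, which is nonzero. *)
Lemma indep_1_x (F : fieldType) (x p q : F) : x != x^-1 ->
  p + q * x = 0 -> p + q * x^-1 = 0 -> p = 0 /\ q = 0.
Proof.
move=> xV pq pqV.
have /eqP : q * (x - x^-1) = 0.
  by transitivity ((p + q * x) - (p + q * x^-1)); [ring | rewrite pq pqV subrr].
rewrite mulf_eq0 subr_eq0 (negPf xV) orbF => /eqP q0.
by move: pq; rewrite q0 mul0r addr0.
Qed.

Notation sym_gens := [tuple lx + lxV; ly + lyV].

(** This is the tensor product of the bases 1, x and 1, y of the two one-variable rings. *)
Definition so4_basis (ij : bool * bool) : Zadjoin_mod sym_gens :=
  (if ij.1 then lx else 1) * (if ij.2 then ly else 1).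

Lemma sum_so4_basis (c : bool * bool -> Zadjoin sym_gens) :
  \sum_ij c ij *: so4_basis ij =
  val (c (false, false)) + val (c (true, false)) * lx
  + (val (c (false, true)) + val (c (true, true)) * lx) * ly :> laurent.
Proof.
transitivity (\sum_i \sum_j val (c (i, j)) *
    ((if i then lx else 1) * (if j then ly else 1)) : laurent).
  by rewrite pair_big; apply: eq_bigr => [[]].
by rewrite !big_bool /= !mul1r !mulr1; ring.
Qed.

Lemma lx_lxV : lx * lxV = 1.
Proof.
apply: val_inj; rewrite rmorphM rmorph1.
by rewrite -[LHS]/(val lx * val lxV) val_lx val_lxV mulfV ?var_x_neq0.
Qed.

Lemma ly_lyV : ly * lyV = 1.
Proof.
apply: val_inj; rewrite rmorphM rmorph1.
by rewrite -[LHS]/(val ly * val lyV) val_ly val_lyV mulfV ?var_y_neq0.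
Qed.

(** * Spanning: coordinates with respect to 1, x, y, xy *)

Section SymmetricCoords.
Variables (A B : comNzRingType) (f : {rmorphism A -> B}).
Variables (x xV y yV : B) (u v : A).
Hypotheses (xxV : x * xV = 1) (yyV : y * yV = 1).
Hypotheses (fu : f u = x + xV) (fv : f v = y + yV).

Definition sym_coords (z : B) : Prop := exists p q r s : A,
  z = f p + f q * x + (f r + f s * x) * y.

Lemma sym_coords1 : sym_coords 1.
Proof. by exists 1, 0, 0, 0; rewrite !rmorph0 rmorph1; ring. Qed.

Lemma sym_coordsB z w : sym_coords z -> sym_coords w -> sym_coords (z - w).
Proof.
move=> [p [q [r [s ->]]]] [p' [q' [r' [s' ->]]]].
by exists (p - p'), (q - q'), (r - r'), (s - s'); rewrite !rmorphB; ring.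
Qed.

Lemma sym_coordsM z w : sym_coords z -> sym_coords w -> sym_coords (z * w).
Proof.
move=> [p [q [r [s ->]]]] [p' [q' [r' [s' ->]]]].
(* Since x^2 = u x - 1, [m] and [n] are the constant and the x-coefficient of the product (a + b
   x)(a' + b' x). *)
pose m a b a' b' : A := a * a' - b * b'.
pose n a b a' b' : A := a * b' + b * a' + b * b' * u.
(* The same rule one level up: y^2 = v y - 1, with coefficients of the form a + b x that are
   multiplied by [m] and [n]. *)
exists (m p q p' q' - m r s r' s'), (n p q p' q' - n r s r' s'),
  (m p q r' s' + m r s p' q' + m r s r' s' * v),
  (n p q r' s' + n r s p' q' + n r s r' s' * v).
have fmn a b a' b' :
    (f a + f b * x) * (f a' + f b' * x) = f (m a b a' b') + f (n a b a' b') * x.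
  by rewrite /m /n rmorphB !rmorphD !rmorphM fu; ring: xxV.
clearbody m n; rewrite !rmorphB !rmorphD !(rmorphM f _ v) fv.
transitivity ((f p + f q * x) * (f p' + f q' * x) +
  ((f p + f q * x) * (f r' + f s' * x) + (f r + f s * x) * (f p' + f q' * x)) * y
  + (f r + f s * x) * (f r' + f s' * x) * (y * y)); first by ring.
by rewrite !fmn; ring: yyV.
Qed.

Lemma sym_coords_x : sym_coords x.
Proof. by exists 0, 1, 0, 0; rewrite !rmorph0 rmorph1; ring. Qed.

Lemma sym_coords_xV : sym_coords xV.
(* The inverse of x is u - x. *)
Proof. by exists u, (- 1), 0, 0; rewrite !rmorph0 rmorphN1 fu; ring. Qed.

Lemma sym_coords_y : sym_coords y.
Proof. by exists 0, 0, 1, 0; rewrite !rmorph0 rmorph1; ring. Qed.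

Lemma sym_coords_yV : sym_coords yV.
Proof. by exists v, 0, (- 1), 0; rewrite !rmorph0 rmorphN1 fv; ring. Qed.

End SymmetricCoords.

Lemma so4_coords (z : laurent) :
  sym_coords (val : Zadjoin sym_gens -> laurent) lx ly z.
Proof.
have uE : val (Zgen sym_gens 0) = lx + lxV by [].
have vE : val (Zgen sym_gens 1) = ly + lyV by [].
elim/Zadjoin_ind: z => [|w z|w z|i].
- exact: sym_coords1.
- exact: sym_coordsB.
- exact: (sym_coordsM lx_lxV ly_lyV uE vE).
- rewrite -[i]inord_val; case: i => [[|[|[|[|//]]]] lt_i] /=.
  + exact: sym_coords_x.
  + exact: sym_coords_xV uE.
  + exact: sym_coords_y.
  + exact: sym_coords_yV vE.
Qed.

(** * Linear independence *)

Definition Laurent_symmetric (F : fieldType) (f : F -> F -> F) : Prop :=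
  (forall a b, f a^-1 b = f a b) /\ (forall a b, f a b^-1 = f a b).

(** The element is a polynomial in x + x^-1 and y + y^-1; letting x and y vary in that expression
    gives the function, and inverting a variable only swaps two summands. *)
Lemma Zadjoin_sym_Laurent (c : Zadjoin sym_gens) :
  exists g : Qxy -> Qxy -> Qxy,
  [/\ Laurent_fun g, g var_x var_y = val (val c) & Laurent_symmetric g].
Proof.
have /asboolP[P cP] := Zadjoin_valP c.
pose h (a b : Qxy) := tnth [tuple a + a^-1; b + b^-1].
exists (fun a b => mmap intr (h a b) P); split.
- apply: Laurent_fun_mmap => -[[|[|//]] lt_i]; rewrite /h /=.
    exact: Laurent_funD (Laurent_fun_fst _) (Laurent_fun_fstV _).
  exact: Laurent_funD (Laurent_fun_snd _) (Laurent_fun_sndV _).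
- rewrite [val c]cP rmorph_mmap_int; congr mmap; apply/funext.
  case=> [[|[|//]] lt_i].
    exact: congr2 (esym val_lx) (esym val_lxV).
  exact: congr2 (esym val_ly) (esym val_lyV).
- by split=> a b; rewrite /h invrK [_^-1 + _]addrC.
Qed.

Lemma Laurent_indep (F : fieldType) (x y : F) (P Q R S : F -> F -> F) :
  (forall f a b, Laurent_fun f -> f x y = 0 -> a != 0 -> b != 0 -> f a b = 0) ->
  x != 0 -> y != 0 -> x != x^-1 -> y != y^-1 ->
  Laurent_fun P -> Laurent_fun Q -> Laurent_fun R -> Laurent_fun S ->
  Laurent_symmetric P -> Laurent_symmetric Q ->
  Laurent_symmetric R -> Laurent_symmetric S ->
  P x y + Q x y * x + (R x y + S x y * x) * y = 0 ->
  [/\ P x y = 0, Q x y = 0, R x y = 0 & S x y = 0].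
Proof.
move=> spec x0 y0 xV yV LP LQ LR LS [PxV PyV] [QxV QyV] [RxV RyV] [SxV SyV] rel.
pose G a b := P a b + Q a b * a + (R a b + S a b * a) * b.
have Lx := Laurent_fun_fst F; have Ly := Laurent_fun_snd F.
have LG : Laurent_fun G.
  apply: Laurent_funD; first exact: Laurent_funD LP (Laurent_funM LQ Lx).
  exact: Laurent_funM (Laurent_funD LR (Laurent_funM LS Lx)) Ly.
have G0 a b : a != 0 -> b != 0 -> G a b = 0 by exact: spec.
have xV0 := invr_neq0 x0; have yV0 := invr_neq0 y0.
have rel_yV := G0 _ _ x0 yV0; have rel_xV := G0 _ _ xV0 y0.
have rel_xVyV := G0 _ _ xV0 yV0.
rewrite /G !(PxV, PyV, QxV, QyV, RxV, RyV, SxV, SyV) in rel_yV rel_xV rel_xVyV.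
(* The four specialized relations share their coefficients. Eliminating y at x and again at x^-1
   leaves two pairs of relations in x alone. *)
have [pq rs] := indep_1_x yV rel rel_yV.
have [pqV rsV] := indep_1_x yV rel_xV rel_xVyV.
have [p0 q0] := indep_1_x xV pq pqV.
by have [r0 s0] := indep_1_x xV rs rsV.
Qed.

Lemma rmorph_coords (A B : comNzRingType) (f : {rmorphism A -> B})
    (p q r s x y : A) :
  f (p + q * x + (r + s * x) * y) = f p + f q * f x + (f r + f s * f x) * f y.
Proof. by rewrite !(rmorphD, rmorphM). Qed.

Lemma so4_indep (p q r s : Zadjoin sym_gens) :
  val p + val q * lx + (val r + val s * lx) * ly = 0 :> laurent ->
  [/\ p = 0, q = 0, r = 0 & s = 0].
Proof.
move=> /(congr1 (val : laurent -> Qxy)) rel.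
have {}rel X Y : val lx = X -> val ly = Y ->
    val (val p) + val (val q) * X + (val (val r) + val (val s) * X) * Y = 0.
  move=> <- <-; apply: etrans rel; apply: esym.
  exact: (rmorph_coords (val : {rmorphism laurent -> Qxy})).
move: (rel _ _ val_lx val_ly) => {}rel.
have val0 (c : Zadjoin sym_gens) : val (val c) = 0 -> c = 0.
  by move=> c0; apply: val_inj; apply: val_inj; exact: c0.
have [P [LP PE PV]] := Zadjoin_sym_Laurent p.
have [Q [LQ QE QV]] := Zadjoin_sym_Laurent q.
have [R [LR RE RV]] := Zadjoin_sym_Laurent r.
have [S [LS SE SV]] := Zadjoin_sym_Laurent s.
move: rel; rewrite -PE -QE -RE -SE => rel.
have [] := Laurent_indep (@Laurent_fun_specialize) var_x_neq0 var_y_neq0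
  (tofracX_neqV _) (tofracX_neqV _) LP LQ LR LS PV QV RV SV rel.
by rewrite PE QE RE SE => /val0-> /val0-> /val0-> /val0->.
Qed.

Theorem mainTheorem4 : free_module (Zadjoin_mod [tuple lx + lxV; ly + lyV]).
Proof.
exists (bool * bool)%type, so4_basis; split.
- move=> s c uniq_s; rewrite big_uniq // big_mkcond /=.
  (* Extending the coefficients by zero turns a relation over a list of distinct indices into one
     over all four basis elements. *)
  pose c' ij := if ij \in s then c ij else 0.
  rewrite (eq_bigr (fun ij => c' ij *: so4_basis ij)); last first.
    by move=> ij _; rewrite /c'; case: ifP; rewrite ?scale0r.
  rewrite sum_so4_basis => /so4_indep[c00 c10 c01 c11] ij s_ij.
  suff : c' ij = 0 by rewrite /c' s_ij.
  by case: ij {s_ij} => [[] []].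
- move=> z; have [p [q [r [s ->]]]] := so4_coords z.
  exists (index_enum _), (fun ij => if ij.2 then if ij.1 then s else r
                        else if ij.1 then q else p).
  by rewrite sum_so4_basis.
Qed.
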